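(* For an integer $k\ge 1$ let $n=2^k$, let $T_k$ be the complete binary tree with $2^k$ leaves, and let $S_n$ be the tree obtained from $T_k$ and a star with $n$ leaves by adding an edge between the root of $T_k$ and the center of the star. Then there is a constant $c>0$ (independent of $n$) such that every rectangular layout of $S_n$ on the integer grid has area at least $c\, n\log n$.
   Context: A (strong) rectangular layout of a graph is a set of axis-parallel rectangles with pairwise disjoint interiors, one per vertex, such that two rectangles' boundaries share a segment of positive length if and only if the corresponding vertices are adjacent. On the integer grid all corners have integer coordinates; the area is that of the smallest enclosing axis-parallel bounding box. *)

(* Defs.v *)
From HB Require Import structures.
From mathcomp Require Export all_boot all_order all_algebra.
From mathcomp Require Export all_classical all_reals all_analysis.

Set Implicit Arguments.
Unset Strict Implicit.
Unset Printing Implicit Defensive.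

Import Order.TTheory GRing.Theory Num.Theory.

Local Open Scope classical_set_scope.
Local Open Scope ring_scope.

(* The vertices of T_k are the binary words of length at most k: the empty    *)
(* word is the root, the children of u are u0 and u1, and the 2 ^ k words of  *)
(* length k are the leaves.                                                   *)
Definition child (k : nat) (u v : k.-bseq bool) : bool :=
  [exists b : bool, val v == rcons (val u) b].

Definition T_adj (k : nat) : rel (k.-bseq bool) :=
  fun u v => child u v || child v u.

Definition T_root (k : nat) : k.-bseq bool := [bseq].

(* None is the center of the star, Some i its i-th leaf. *)
Definition star_adj (n : nat) : rel (option 'I_n) :=
  fun u v => (u == None) (+) (v == None).

Definition star_center (n : nat) : option 'I_n := None.

(* The disjoint union of two graphs plus one edge between a and b. *)
Definition join_adj (V W : finType) (e : rel V) (f : rel W) (a : V) (b : W) :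
    rel (V + W)%type :=
  fun u v => match u, v with
  | inl x, inl y => e x y
  | inr x, inr y => f x y
  | inl x, inr y => (x == a) && (y == b)
  | inr x, inl y => (y == a) && (x == b)
  end.

Definition S_vertex (k : nat) : finType :=
  (k.-bseq bool + option 'I_(2 ^ k))%type.

Definition S_adj (k : nat) : rel (S_vertex k) :=
  join_adj (@T_adj k) (@star_adj (2 ^ k)) (T_root k) (star_center (2 ^ k)).

Lemma card_T_leaves (k : nat) :
  #|[pred u : k.-bseq bool | size u == k]| = (2 ^ k)%N.
Proof.
rewrite -card_bool -card_tuple.
have h (t : k.-tuple bool) : (size t <= k)%N by rewrite size_tuple.
have inj_f : injective (fun t => Bseq (h t)).
  by move=> s t /(congr1 val) /= /val_inj.
rewrite -(fintype.card_image inj_f).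
apply: eq_card => u; rewrite inE; apply/idP/fintype.imageP => [su|[t _ ->]].
  by exists (Tuple su) => //; apply: val_inj.
by rewrite size_tuple.
Qed.

Lemma T_adj_sym (k : nat) : symmetric (@T_adj k).
Proof. by move=> u v; rewrite /T_adj orbC. Qed.

Lemma T_adj_irrefl (k : nat) : irreflexive (@T_adj k).
Proof.
move=> u; rewrite /T_adj orbb; apply/negbTE/existsP => -[b /eqP/(congr1 size)].
by rewrite size_rcons => /esym/eqP; rewrite -[X in _ == X]addn0 -addn1 eqn_add2l.
Qed.

Lemma S_adj_sym (k : nat) : symmetric (@S_adj k).
Proof. by case=> x [y|y] //=; rewrite ?[T_adj x y]T_adj_sym // /star_adj addbC. Qed.

Lemma S_adj_irrefl (k : nat) : irreflexive (@S_adj k).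
Proof. by case=> x /=; [rewrite T_adj_irrefl | rewrite /star_adj addbb]. Qed.

Record rect (R : realType) := Rect {
  xmin : R; xmax : R; ymin : R; ymax : R;
  rect_x : xmin < xmax;
  rect_y : ymin < ymax
}.

Definition rect_closed (R : realType) (r : rect R) : set (R * R) :=
  `[xmin r, xmax r] `*` `[ymin r, ymax r].

Definition rect_interior (R : realType) (r : rect R) : set (R * R) :=
  `]xmin r, xmax r[ `*` `]ymin r, ymax r[.

Definition rect_boundary (R : realType) (r : rect R) : set (R * R) :=
  rect_closed r `\` rect_interior r.

Definition segment (R : realType) (p q : R * R) : set (R * R) :=
  [set ((1 - t) * p.1 + t * q.1, (1 - t) * p.2 + t * q.2) | t in `[0, 1]].

Definition share_segment (R : realType) (r s : rect R) : Prop :=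
  exists p q : R * R, p <> q /\
    segment p q `<=` rect_boundary r `&` rect_boundary s.

Definition rectangular_layout (R : realType) (V : finType) (e : rel V)
    (L : V -> rect R) : Prop :=
  forall u v : V, u != v ->
    rect_interior (L u) `&` rect_interior (L v) = set0 /\
    (share_segment (L u) (L v) <-> e u v).

Definition on_integer_grid (R : realType) (V : finType) (L : V -> rect R) : Prop :=
  forall v : V,
    [/\ xmin (L v) \is a Num.int, xmax (L v) \is a Num.int,
        ymin (L v) \is a Num.int & ymax (L v) \is a Num.int].

(* The smallest box enclosing the layout is                                   *)
(* [inf xmin, sup xmax] x [inf ymin, sup ymax].                               *)
Definition layout_area (R : realType) (V : finType) (L : V -> rect R) : R :=
  (sup (range (fun v => xmax (L v))) - inf (range (fun v => xmin (L v)))) *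
  (sup (range (fun v => ymax (L v))) - inf (range (fun v => ymin (L v)))).

(* Main.v *)
(** Each leaf of the star touches one of the four sides of the center, hence
meets one of the four unit-wide grid strips just outside these sides. As the
boxes are integral and disjoint, a strip meets at most as many of them as it
has cells, so [n <= 2 * (W + H)] for a [W] x [H] bounding box. On the other
hand some column and some row of the grid meet more than [k / 2] boxes of the
tree (the pathwidth argument), so both [W] and [H] exceed [k / 2], and
[n * k <= 8 * W * H] follows. *)

Require Import Defs.
From mathcomp Require Import all_boot all_order all_algebra.
From mathcomp Require Import all_classical all_reals all_analysis.
From mathcomp Require Import zify lra.

Set Implicit Arguments.
Unset Strict Implicit.
Unset Printing Implicit Defensive.

Import Order.TTheory GRing.Theory Num.Theory.

Local Open Scope ring_scope.

(** * Disjoint integer boxes and grid columns *)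

Definition boxes_disjoint (V : finType) (x0 x1 y0 y1 : V -> int) : Prop :=
  forall u v, u != v ->
    [\/ x1 u <= x0 v, x1 v <= x0 u, y1 u <= y0 v | y1 v <= y0 u].

Lemma boxes_disjoint_tr (V : finType) (x0 x1 y0 y1 : V -> int) :
  boxes_disjoint x0 x1 y0 y1 -> boxes_disjoint y0 y1 x0 x1.
Proof.
by move=> H u v /H [] h; [apply: Or43|apply: Or44|apply: Or41|apply: Or42]. Qed.

(** Integrality makes [x0 v <= p < x1 v] say that the box spans the whole strip from p to p + 1. Two
    such boxes can only be separated vertically, so their bottom sides are distinct integers in [Y0,
    Y1). *)
Lemma card_column (V : finType) (x0 x1 y0 y1 : V -> int) (Y0 Y1 p : int)
    (A : {set V}) :
  boxes_disjoint x0 x1 y0 y1 -> (forall v, Y0 <= y0 v /\ y1 v <= Y1) ->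
  (forall v, y0 v < y1 v) -> {in A, forall v, x0 v <= p < x1 v} ->
  (#|A| <= `|Y1 - Y0|)%N.
Proof.
move=> dis box pos col; pose f v := `|y0 v - Y0|%N.
have f_inj : {in A &, injective f}.
  move=> u v /col cu /col cv; rewrite /f => fuv; apply/eqP/negPn/negP => /dis.
  have := box u; have := box v; have := pos u; have := pos v.
  by move=> ? ? ? ? [] ?; lia.
rewrite cardE -(size_map f) -(size_iota 0 `|Y1 - Y0|).
apply: uniq_leq_size => [|i /mapP[v _ ->]].
  rewrite map_inj_in_uniq ?enum_uniq // => u v.
  by rewrite !mem_enum; exact: f_inj.
by rewrite mem_iota /f; have := box v; have := pos v; lia.
Qed.

(** * Stabbing many intervals of a binary tree *)

Section Words.
Variables (k : nat) (lo hi : seq bool -> int).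
Hypothesis lo_hi : forall w, lo w < hi w.
Hypothesis touch : forall w b, (size w < k)%N ->
  lo w <= hi (rcons w b) /\ lo (rcons w b) <= hi w.

(** A discrete intermediate value argument. An interval missing the cell [p, p + 1] ends at or
    before p or starts at or after p + 1, and touching intervals cannot lie on opposite sides; so a
    path changing sides must cross the cell. *)
Lemma ancestor_crossing (p : int) (u w : seq bool) :
  prefix u w -> (size w <= k)%N ->
  lo u <= p /\ p < hi w \/ p < hi u /\ lo w <= p ->
  exists t, [/\ prefix u t, prefix t w & lo t <= p < hi t].
Proof.
case/prefixP=> s ->; elim/last_ind: s => [|s b IHs].
  by rewrite cats0 => _ h; exists u; rewrite prefix_refl; split=> //; lia.
rewrite -rcons_cat size_rcons => lt_k h.
have [tch1 tch2] := touch b lt_k.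
(* Either the last word of the path crosses, or its parent is in the same position relative to p and
   the induction continues. *)
have [cw|IHh] : lo (rcons (u ++ s) b) <= p < hi (rcons (u ++ s) b) \/
    (lo u <= p /\ p < hi (u ++ s) \/ p < hi u /\ lo (u ++ s) <= p).
- move: tch1 tch2 h.
  move: (lo (u ++ s)) (hi (u ++ s)) (lo (rcons _ _)) (hi (rcons _ _)).
  by move=> ? ? ? ?; lia.
- exists (rcons (u ++ s) b); rewrite prefix_refl; split=> //.
  by rewrite rcons_cat prefix_prefix.
have [t [ut tus ct]] := IHs (ltnW lt_k) IHh.
exists t; split=> //.
by apply: (prefix_trans tus); rewrite prefix_rcons.
Qed.

(** Wherever u lies relative to p, one of [w1], [w3] is a suitable other end of a path. The path
    stays outside the subtree of z, since a word on it extending z would make its end extend z. *)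
Lemma crossing_outside (p : int) (u z w1 w3 : seq bool) :
  (size u < size z)%N -> prefix u w1 -> prefix u w3 ->
  ~~ prefix z w1 -> ~~ prefix z w3 -> (size w1 <= k)%N -> (size w3 <= k)%N ->
  lo w1 <= p -> p < hi w3 ->
  exists t, [/\ prefix u t, ~~ prefix z t, (size t <= k)%N & lo t <= p < hi t].
Proof.
move=> uz uw1 uw3 zw1 zw3 s1 s3 l1 h3.
have anc w : prefix u w -> ~~ prefix z w -> (size w <= k)%N ->
    lo u <= p /\ p < hi w \/ p < hi u /\ lo w <= p ->
    exists t, [/\ prefix u t, ~~ prefix z t, (size t <= k)%N & lo t <= p < hi t].
  move=> uw zw sw /(ancestor_crossing uw sw)[t [ut tw ct]]; exists t; split=> //.
    by apply: contra zw => zt; apply: (prefix_trans zt).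
  exact: leq_trans (size_prefix tw) sw.
have [lup|pu] := leP (lo u) p; first by apply: (anc w3) => //; left.
by apply: (anc w1) => //; right; split=> //; have := lo_hi u; lia.
Qed.

Lemma prefix_same_size (z z' w : seq bool) :
  size z = size z' -> z != z' -> prefix z w -> ~~ prefix z' w.
Proof. by rewrite !prefixE => -> zz' /eqP ->. Qed.

(* Of three grandchildren subtrees, one is stabbed at a position between those *)
(* of the other two; these two and the paths joining them to u form a          *)
(* connected set, which has to cross the middle position as well.              *)
Lemma stabbing (j : nat) (u : seq bool) : (size u + j.*2 <= k)%N ->
  exists (p : int) (A : seq (seq bool)), [/\ uniq A, size A = j.+1 &
    {in A, forall w, [/\ prefix u w, (size w <= k)%N & lo w <= p < hi w]}].
Proof.
elim: j u => [|j IHj] u le_k.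
  exists (lo u), [:: u]; split=> // w; rewrite inE => /eqP ->.
  by rewrite prefix_refl lexx lo_hi -[size u]addn0.
pose stab z p := exists A : seq (seq bool), [/\ uniq A, size A = j.+1 &
  {in A, forall w, [/\ prefix z w, (size w <= k)%N & lo w <= p < hi w]}].
(* Two levels are spent per additional interval: three disjoint subtrees are needed, and children
   alone provide only two. *)
have sub a b : exists p, stab (u ++ [:: a; b]) p.
  by apply: IHj; rewrite size_cat /=; lia.
have pick z p : stab z p ->
    exists w, [/\ prefix z w, (size w <= k)%N & lo w <= p < hi w].
  by case=> -[[] //|w A] [_ _ HA]; exists w; apply: HA; rewrite mem_head.
(* Here z2 is the subtree stabbed at the middle position [p2]; its [j.+1] words are joined by a word
   t outside it. *)
have mid z1 z2 z3 p1 p2 p3 : size z1 = (size u).+2 -> size z2 = (size u).+2 ->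
    size z3 = (size u).+2 -> prefix u z1 -> prefix u z2 -> prefix u z3 ->
    z1 != z2 -> z3 != z2 -> stab z1 p1 -> stab z2 p2 -> stab z3 p3 ->
    p1 <= p2 -> p2 <= p3 -> exists (p : int) (A : seq (seq bool)),
    [/\ uniq A, size A = j.+2 & {in A, forall w,
      [/\ prefix u w, (size w <= k)%N & lo w <= p < hi w]}].
  move=> e1 e2 e3 u1 u2 u3 d1 d3 st1 [A2 [U2 S2 H2]] st3 p12 p23.
  have [w1 [z1w sw1 c1]] := pick _ _ st1.
  have [w3 [z3w sw3 c3]] := pick _ _ st3.
  have [|||||//|//|||t [ut z2t st ct]] := @crossing_outside p2 u z2 w1 w3.
  - by rewrite e2.
  - exact: prefix_trans u1 z1w.
  - exact: prefix_trans u3 z3w.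
  - by apply: prefix_same_size z1w; rewrite ?e1.
  - by apply: prefix_same_size z3w; rewrite ?e3.
  - by case/andP: c1 => c1 _; apply: le_trans c1 p12.
  - by case/andP: c3 => _ c3; apply: le_lt_trans p23 c3.
  exists p2, (t :: A2); split=> /=; rewrite ?S2 ?U2 ?andbT //.
    by apply: contra z2t => /H2[].
  by move=> w; rewrite inE => /orP[/eqP -> //|/H2[z2w ? ?]]; split=> //;
    apply: prefix_trans z2w.
have [p1 s1] := sub false false; have [p2 s2] := sub false true.
have [p3 s3] := sub true false.
have sz a b : size (u ++ [:: a; b]) = (size u).+2 by rewrite size_cat addn2.
have ne (a b a' b' : bool) : [:: a; b] != [:: a'; b'] ->
    u ++ [:: a; b] != u ++ [:: a'; b'] by rewrite eqseq_cat // eqxx.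
have use := fun a1 b1 a2 b2 a3 b3 q1 q2 q3 n1 n3 => mid _ _ _ q1 q2 q3
  (sz a1 b1) (sz a2 b2) (sz a3 b3) (prefix_prefix _ _) (prefix_prefix _ _)
  (prefix_prefix _ _) (ne a1 b1 a2 b2 n1) (ne a3 b3 a2 b2 n3).
(* Sort the three positions. The two cyclic cases force equalities and are handled like the
   others. *)
have [l12|/ltW l21] := leP p1 p2; have [l23|/ltW l32] := leP p2 p3;
  have [l13|/ltW l31] := leP p1 p3.
- exact: (use _ _ _ _ _ _ p1 p2 p3 _ _ s1 s2 s3).
- exact: (use _ _ _ _ _ _ p1 p2 p3 _ _ s1 s2 s3).
- exact: (use _ _ _ _ _ _ p1 p3 p2 _ _ s1 s3 s2).
- exact: (use _ _ _ _ _ _ p3 p1 p2 _ _ s3 s1 s2).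
- exact: (use _ _ _ _ _ _ p2 p1 p3 _ _ s2 s1 s3).
- exact: (use _ _ _ _ _ _ p2 p3 p1 _ _ s2 s3 s1).
- exact: (use _ _ _ _ _ _ p3 p2 p1 _ _ s3 s2 s1).
- exact: (use _ _ _ _ _ _ p3 p2 p1 _ _ s3 s2 s1).
Qed.
End Words.

Lemma tree_height (k : nat) (x0 x1 y0 y1 : k.-bseq bool -> int) (Y0 Y1 : int) :
  boxes_disjoint x0 x1 y0 y1 -> (forall v, Y0 <= y0 v /\ y1 v <= Y1) ->
  (forall v, x0 v < x1 v) -> (forall v, y0 v < y1 v) ->
  (forall u v, T_adj u v -> x0 u <= x1 v) -> (k./2 < `|Y1 - Y0|)%N.
Proof.
(* Words longer than k are sent to a default vertex, which keeps their intervals nonempty; [touch]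
   only concerns words of length at most k. *)
move=> dis box px py adj; pose node : seq bool -> _ := @insub_bseq k bool.
have nodeK w : (size w <= k)%N -> val (node w) = w.
  by move=> sw; rewrite /node /insub_bseq val_insubd sw.
have node_adj w b : (size w < k)%N -> T_adj (node w) (node (rcons w b)).
  move=> sw; apply/orP; left; apply/existsP; exists b.
  by rewrite !nodeK ?size_rcons // ltnW.
have [|||p [A [uA sA HA]]] := @stabbing k (x0 \o node) (x1 \o node) _ _ k./2 [::].
- by move=> w; exact: px.
- by move=> w b sw; split=> /=; apply: adj; rewrite ?node_adj // T_adj_sym node_adj.
- by rewrite add0n -[leqRHS]odd_double_half leq_addl.
have uN : uniq (map node A).
  rewrite map_inj_in_uniq // => u v /HA[_ su _] /HA[_ sv _] /(congr1 val).
  by rewrite !nodeK.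
have := @card_column _ _ _ _ _ _ _ p [set v in map node A] dis box py.
rewrite cardsE (card_uniqP uN) size_map sA; apply=> v.
by rewrite inE => /mapP[w /HA[_ _ cw] ->].
Qed.

(** * The leaves around the center of the star *)

Lemma star_perimeter (n : nat) (x0 x1 y0 y1 : option 'I_n -> int)
    (X0 X1 Y0 Y1 : int) :
  boxes_disjoint x0 x1 y0 y1 ->
  (forall v, X0 <= x0 v /\ x1 v <= X1) -> (forall v, Y0 <= y0 v /\ y1 v <= Y1) ->
  (forall v, x0 v < x1 v) -> (forall v, y0 v < y1 v) ->
  (forall u v, star_adj u v -> x0 u <= x1 v /\ y0 u <= y1 v) ->
  (forall u v, star_adj u v -> (x0 u < x1 v /\ x0 v < x1 u) \/
                               (y0 u < y1 v /\ y0 v < y1 u)) ->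
  (n <= 2 * (`|X1 - X0| + `|Y1 - Y0|))%N.
Proof.
move=> dis boxX boxY px py adj sadj.
pose col p := [set v | x0 v <= p < x1 v]; pose row p := [set v | y0 v <= p < y1 v].
have colE p : (#|col p| <= `|Y1 - Y0|)%N.
  by apply: (card_column (p := p) dis boxY) => // v; rewrite inE.
have rowE p : (#|row p| <= `|X1 - X0|)%N.
  by apply: (card_column (p := p) (boxes_disjoint_tr dis) boxX) => // v; rewrite inE.
have <- : #|[set~ None : option 'I_n]| = n by rewrite cardsC1 card_option card_ord.
(* On a separating axis, touching forces the facing sides of leaf and center to coincide. The leaf
   then occupies the unit strip beyond that side, which has index [x1 None] on the right and
   [x0 None - 1] on the left; likewise for rows. *)
have cover : [set~ None : option 'I_n] \subset
    (col (x1 None) :|: col (x0 None - 1)) :|: (row (y1 None) :|: row (y0 None - 1)).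
  apply/fintype.subsetP => v; rewrite !inE => vN.
  have av : star_adj v None by rewrite /star_adj eqxx (negbTE vN).
  have av' : star_adj None v by rewrite /star_adj eqxx (negbTE vN).
  have [h1 h2] := adj _ _ av; have [h3 h4] := adj _ _ av'.
  have h5 := sadj _ _ av; have := px v; have := py v.
  by case: (dis _ _ vN) => h *; lia.
apply: leq_trans (subset_leq_card cover) _.
apply: leq_trans (leq_card_setU _ _) _; rewrite mulnDr !mul2n -!addnn addnC.
by apply: leq_add; apply: leq_trans (leq_card_setU _ _) _; apply: leq_add.
Qed.

(** * From real rectangles to integer boxes *)

Section Rectangles.
Variable R : realType.
Implicit Types (r s : rect R) (a b c d : R).

Lemma share_segment_le r s : share_segment r s ->
  xmin r <= xmax s /\ ymin r <= ymax s.
Proof.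
case=> p [q [_ H]]; have [] : (rect_boundary r `&` rect_boundary s)%classic p.
  apply: H; exists 0; first by rewrite /= in_itv /= lexx ler01.
  by case: p => ? ? /=; rewrite !subr0 !mul1r !mul0r !addr0.
by rewrite /rect_boundary /rect_closed /= !in_itv /= => -[[/andP[? ?] /andP[? ?]] _]
  [[/andP[? ?] /andP[? ?]] _]; split; lra.
Qed.

(** The two ends of the shared segment lie in both rectangles and differ in some coordinate, so on
    that axis the projections overlap in positive length. *)
Lemma share_segment_lt r s : share_segment r s ->
  (xmin r < xmax s /\ xmin s < xmax r) \/ (ymin r < ymax s /\ ymin s < ymax r).
Proof.
case=> p [q [pq H]].
have [] : (rect_boundary r `&` rect_boundary s)%classic p.
  apply: H; exists 0; first by rewrite /= in_itv /= lexx ler01.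
  by case: p {pq} => ? ? /=; rewrite !subr0 !mul1r !mul0r !addr0.
have [] : (rect_boundary r `&` rect_boundary s)%classic q.
  apply: H; exists 1; first by rewrite /= in_itv /= lexx ler01.
  by case: q {pq} => ? ? /=; rewrite !subrr !mul1r !mul0r !add0r.
rewrite /rect_boundary /rect_closed /= !in_itv /=.
move=> [[/andP[? ?] /andP[? ?]] _] [[/andP[? ?] /andP[? ?]] _].
move=> [[/andP[? ?] /andP[? ?]] _] [[/andP[? ?] /andP[? ?]] _].
have [e1|] := eqVneq p.1 q.1; last by rewrite neq_lt => /orP[] ?; left; split; lra.
have [e2|] := eqVneq p.2 q.2; last by rewrite neq_lt => /orP[] ?; right; split; lra.
by case: pq; rewrite (surjective_pairing p) (surjective_pairing q) e1 e2.
Qed.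

Lemma open_intervals_meet a b c d : a < b -> c < d -> a < d -> c < b ->
  exists t, a < t < b /\ c < t < d.
Proof.
move=> ab cd ad cb; exists ((Num.max a c + Num.min b d) / 2).
by case: (leP a c); case: (leP b d) => *; split; lra.
Qed.

(** Interiors are products of open intervals: if no axis separates them, a common point is built
    coordinate by coordinate. *)
Lemma disjoint_interiors r s :
  (rect_interior r `&` rect_interior s)%classic = classical_sets.set0 ->
  [\/ xmax r <= xmin s, xmax s <= xmin r, ymax r <= ymin s | ymax s <= ymin r].
Proof.
move=> rs0.
have [|h1] := leP (xmax r) (xmin s); first by constructor 1.
have [|h2] := leP (xmax s) (xmin r); first by constructor 2.
have [|h3] := leP (ymax r) (ymin s); first by constructor 3.
have [|h4] := leP (ymax s) (ymin r); first by constructor 4.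
have [x [xr xs]] := open_intervals_meet (rect_x r) (rect_x s) h2 h1.
have [y [yr ys]] := open_intervals_meet (rect_y r) (rect_y s) h4 h3.
have : (rect_interior r `&` rect_interior s)%classic (x, y).
  by rewrite /rect_interior; split; split; rewrite /= in_itv.
by rewrite rs0.
Qed.

Lemma le_sup_fin (V : finType) (f : V -> R) v : f v <= sup (range f).
Proof.
apply: ub_le_sup; last by exists v.
exists (\big[Num.max/f v]_w f w) => _ [w _ <-]; exact: le_bigmax.
Qed.

Lemma inf_fin_le (V : finType) (f : V -> R) v : inf (range f) <= f v.
Proof.
apply: ge_inf; last by exists v.
exists (\big[Num.min/f v]_w f w) => _ [w _ <-]; exact: bigmin_le.
Qed.

Lemma integral_extent (V : finType) (v0 : V) (f g : V -> R) :
  (forall v, f v \is a Num.int) -> (forall v, g v \is a Num.int) ->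
  (forall v, f v < g v) ->
  exists X0 X1 : int,
    (forall v, X0 <= Num.floor (f v) /\ Num.floor (g v) <= X1) /\
    `|X1 - X0|%:R <= sup (range g) - inf (range f).
Proof.
move=> fint gint fg.
(* Rounding inwards can only shorten the extent, and it excludes no integral coordinate. *)
exists (Num.ceil (inf (range f))), (Num.floor (sup (range g))).
have box v : Num.ceil (inf (range f)) <= Num.floor (f v) /\
             Num.floor (g v) <= Num.floor (sup (range g)).
  by rewrite ceil_le_int floor_ge_int !floorK ?inf_fin_le ?le_sup_fin.
split=> //; have [h1 h2] := box v0.
have h3 : Num.floor (f v0) <= Num.floor (g v0).
  by rewrite floor_ge_int floorK // ltW.
have h : 0 <= Num.floor (sup (range g)) - Num.ceil (inf (range f)) by lia.
rewrite -[X in X <= _]/((Posz _)%:~R) gez0_abs // intrB lerB //.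
  exact: floor_le.
exact: ceil_ge.
Qed.

End Rectangles.

Lemma mul_le_of_perimeter (n k w h : nat) :
  (k./2 < w)%N -> (k./2 < h)%N -> (n <= 2 * (w + h))%N -> (n * k <= 8 * (w * h))%N.
Proof.
move=> kw kh nwh.
(* The larger of w and h is at least n / 4, and the smaller is at least k / 2. *)
have [wh|/ltnW hw] := leqP w h.
  have -> : (8 * (w * h) = (4 * h) * (2 * w))%N by lia.
  by apply: leq_mul; lia.
have -> : (8 * (w * h) = (4 * w) * (2 * h))%N by lia.
by apply: leq_mul; lia.
Qed.

Theorem theorem7 (R : realType) :
  exists c : R, 0 < c /\
    forall k n : nat, (1 <= k)%N -> n = (2 ^ k)%N ->
    forall L : S_vertex k -> rect R,
      rectangular_layout (@S_adj k) L -> on_integer_grid L ->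
      c * (n%:R * ln (n%:R)) <= layout_area L.
Proof.
(* The constant comes from [n * k <= 8 * (w * h)] combined with [ln n <= k]. *)
exists (1 / 8); split; first by lra.
move=> k n _ -> L lay grid.
have ix0 v : xmin (L v) \is a Num.int by case: (grid v).
have ix1 v : xmax (L v) \is a Num.int by case: (grid v).
have iy0 v : ymin (L v) \is a Num.int by case: (grid v).
have iy1 v : ymax (L v) \is a Num.int by case: (grid v).
have v0 : S_vertex k := inr None.
have [X0 [X1 [boxX WX]]] := integral_extent v0 ix0 ix1 (fun v => rect_x (L v)).
have [Y0 [Y1 [boxY WY]]] := integral_extent v0 iy0 iy1 (fun v => rect_y (L v)).
pose x0 v := Num.floor (xmin (L v)); pose x1 v := Num.floor (xmax (L v)).
pose y0 v := Num.floor (ymin (L v)); pose y1 v := Num.floor (ymax (L v)).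
(* On integral reals [Num.floor] preserves and reflects order, so the geometry carries over to [int]
   without loss. *)
have floor_leE (a b : R) : a \is a Num.int -> b \is a Num.int ->
    (Num.floor a <= Num.floor b) = (a <= b).
  by move=> ia ib; rewrite floor_ge_int floorK.
have floor_ltE (a b : R) : a \is a Num.int -> b \is a Num.int ->
    (Num.floor a < Num.floor b) = (a < b).
  by move=> ia ib; rewrite !ltNge floor_leE.
have px v : x0 v < x1 v by rewrite floor_ltE // rect_x.
have py v : y0 v < y1 v by rewrite floor_ltE // rect_y.
have dis : boxes_disjoint x0 x1 y0 y1.
  move=> u v uv; rewrite !floor_leE //.
  by apply: disjoint_interiors; case: (lay u v uv).
have share u v : S_adj u v -> share_segment (L u) (L v).
  move=> uv; have nuv : u != v by apply: contraTneq uv => ->; rewrite S_adj_irrefl.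
  by have [_ [_]] := lay u v nuv; apply.
have adjx u v : S_adj u v -> x0 u <= x1 v.
  by move=> /share/share_segment_le[? _]; rewrite floor_leE.
have adjy u v : S_adj u v -> y0 u <= y1 v.
  by move=> /share/share_segment_le[_ ?]; rewrite floor_leE.
have sadj u v : S_adj u v ->
    (x0 u < x1 v /\ x0 v < x1 u) \/ (y0 u < y1 v /\ y0 v < y1 u).
  by move=> /share/share_segment_lt; rewrite !floor_ltE.
have disT : boxes_disjoint (x0 \o inl) (x1 \o inl) (y0 \o inl) (y1 \o inl).
  by move=> u v uv; apply: dis.
have disS : boxes_disjoint (x0 \o inr) (x1 \o inr) (y0 \o inr) (y1 \o inr).
  by move=> u v uv; apply: dis.
have kh : (k./2 < `|Y1 - Y0|)%N.
  apply: tree_height disT _ _ _ _ => [v|v|v|u v uv]; [exact: boxY|exact: px|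
    exact: py|exact: adjx].
(* The same tree bound with the axes exchanged: a row is stabbed instead of a column. *)
have kw : (k./2 < `|X1 - X0|)%N.
  apply: tree_height (boxes_disjoint_tr disT) _ _ _ _ => [v|v|v|u v uv];
    [exact: boxX|exact: py|exact: px|exact: adjy].
have nwh : (2 ^ k <= 2 * (`|X1 - X0| + `|Y1 - Y0|))%N.
  apply: star_perimeter disS _ _ _ _ _ _ => [v|v|v|v|u v uv|u v uv];
    [exact: boxX|exact: boxY|exact: px|exact: py|split|exact: sadj].
    exact: adjx.
  exact: adjy.
have key := mul_le_of_perimeter kw kh nwh.
(* This is k times ln 2 <= 1, an instance of ln (1 + x) <= x at x = 1. *)
have lnk : ln ((2 ^ k)%:R : R) <= k%:R.
  rewrite natrX lnXn // -[leLHS]mulr_natl -[leRHS]mulr1 ler_wpM2l //.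
  by have -> : 2%:R = 1 + 1 :> R by []; apply: le_ln1Dx; lra.
have area : `|X1 - X0|%:R * `|Y1 - Y0|%:R <= layout_area L.
  by rewrite /layout_area ler_pM.
have keyR : (2 ^ k)%:R * k%:R <= 8 * (`|X1 - X0|%:R * `|Y1 - Y0|%:R) :> R.
  by rewrite -!natrM ler_nat.
have := ler_wpM2l (ler0n R (2 ^ k)) lnk.
by lra.
Qed.
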